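(* (i) Let $\mathbb{F}$ be any field, let $D_1,D_2,t,s$ be positive integers, and let $G$ be an algebraic graph of description complexity at most $t$ on vertex set $\mathcal{P}\cup\mathcal{Q}$, where $\mathcal{P}\subseteq\mathbb{F}^{D_1}$, $\mathcal{Q}\subseteq\mathbb{F}^{D_2}$, $|\mathcal{P}|=m$, $|\mathcal{Q}|=n$. If $G$ contains no copy of $K_{s,s}$, then the number of edges of $G$ is at most $C\min\{m^{1-1/D_1}n,\; m n^{1-1/D_2}\}$, where $C$ depends only on $D_1,D_2,t,s$. (ii) Conversely, for every $D_1,D_2$ there exists $t$ such that if $m,n$ are sufficiently large and $s\ge D_1+D_2$, then there exist a field $\mathbb{F}$ and an algebraic graph $G$ of description complexity at most $t$ with parts $\mathcal{P}\subseteq\mathbb{F}^{D_1}$, $\mathcal{Q}\subseteq\mathbb{F}^{D_2}$ of sizes $m$ and $n$, containing no copy of $K_{s,s}$, with at least $c\min\{m^{1-1/D_1}n,\; m n^{1-1/D_2}\}$ edges, where $c>0$ is a constant.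
   Context: Given $\mathcal{P}\subseteq\mathbb{F}^{D_1}$, $\mathcal{Q}\subseteq\mathbb{F}^{D_2}$, polynomials $f_1,\dots,f_t:\mathbb{F}^{D_1}\times\mathbb{F}^{D_2}\to\mathbb{F}$ and a Boolean formula $\Phi$, the associated algebraic graph is the bipartite graph on $\mathcal{P}\cup\mathcal{Q}$ in which $x\in\mathcal{P}$ and $y\in\mathcal{Q}$ are adjacent iff $\Phi([f_1(x,y)=0],\dots,[f_t(x,y)=0])=1$, where $[f_i(x,y)=0]$ is the truth value of that equation. The graph has description complexity at most $t$ if it can be described in this way by at most $t$ polynomials, each of degree at most $t$.
   Formalization: In (i) the edge bound is proved as C(min{m^{1-1/D1} n, m n^{1-1/D2}} + m + n), since the bound without m + n fails for stars (n = 1, all pairs adjacent, s = 2); it gives the stated bound when m ≤ n^{D1} and n ≤ m^{D2}. *)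

(* Defs.v *)
From HB Require Import structures.
From mathcomp Require Import all_boot all_order all_algebra finmap.
From mathcomp Require Import mpoly.
From mathcomp Require Import reals exp.

Set Implicit Arguments.
Unset Strict Implicit.
Unset Printing Implicit Defensive.

Local Open Scope fset_scope.
Local Open Scope ring_scope.

Inductive bool_formula (k : nat) : Type :=
  | BVar of 'I_k
  | BConst of bool
  | BNot of bool_formula k
  | BAnd of bool_formula k & bool_formula k
  | BOr of bool_formula k & bool_formula k.

Fixpoint bf_eval (k : nat) (v : 'I_k -> bool) (Phi : bool_formula k) : bool :=
  match Phi with
  | BVar i => v i
  | BConst b => b
  | BNot A => ~~ bf_eval v A
  | BAnd A B => bf_eval v A && bf_eval v B
  | BOr A B => bf_eval v A || bf_eval v B
  end.

(* A bipartite graph with parts P and Q is given by a boolean relation adj, of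
   which only the values on P x Q matter; the two parts are kept apart by their
   position, so they count as disjoint even when D1 = D2 and P meets Q. *)

(* msize p is the total degree of p plus one, and 0 for p = 0. *)
Definition has_complexity_le (F : fieldType) (D1 D2 t : nat)
    (P : {fset 'rV[F]_D1}) (Q : {fset 'rV[F]_D2})
    (adj : 'rV[F]_D1 -> 'rV[F]_D2 -> bool) : Prop :=
  exists (k : nat) (f : 'I_k -> {mpoly F[D1 + D2]}) (Phi : bool_formula k),
    [/\ (k <= t)%N,
        forall i, (msize (f i) <= t.+1)%N
      & forall x y, x \in P -> y \in Q ->
          adj x y = bf_eval (fun i => (f i).@[row_mx x y 0] == 0) Phi].

Definition edges (U V : choiceType) (P : {fset U}) (Q : {fset V})
    (adj : U -> V -> bool) : {fset U * V} :=
  [fset e in P `*` Q | adj e.1 e.2].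

(* For s > 0, K_{s,s} is connected, so a copy of it in a bipartite graph has one
   side in each part. *)
Definition contains_Kss (U V : choiceType) (P : {fset U}) (Q : {fset V})
    (adj : U -> V -> bool) (s : nat) : Prop :=
  exists (A : {fset U}) (B : {fset V}),
    [/\ A `<=` P, B `<=` Q, #|` A| = s, #|` B| = s
      & forall x y, x \in A -> y \in B -> adj x y].

Definition edge_bound (R : realType) (D1 D2 m n : nat) : R :=
  Num.min (powR m%:R (1 - D1%:R^-1) * n%:R)
          (m%:R * powR n%:R (1 - D2%:R^-1)).

(* Main.v *)
Require Import Defs.
From mathcomp Require Import all_boot all_order all_algebra all_field finmap.
From mathcomp Require Import mpoly zify ring.
From mathcomp Require Import reals exp.

Set Implicit Arguments.
Unset Strict Implicit.
Unset Printing Implicit Defensive.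

Import Order.TTheory GRing.Theory Num.Theory.

(** Upper bound.  By the rank argument of Ronyai, Babai and Ganapathy the
neighbourhoods of the points of F^D leave O(z^D) traces on z vertices of the
other side.  By Haussler's exchangeability argument on unit distance graphs
there is a set Y of z vertices such that the vertices y of the other side split
the trace classes of Y very unevenly: the sum over y of the sizes of the smaller
halves is O(mn/z).  Cutting every class into blocks of s points, K_{s,s}-freeness
bounds the incidences of a block by its number of splitting vertices, and only
O(z^D) points are left over.  With z running through the powers of 2 the losses
form a geometric series when D >= 2; when D = 1, every neighbourhood is bounded
or co-bounded.

Lower bound.  Over GF(q) with q about max(m^(1/D1), n^(1/D2)), take the zero set
of a random polynomial of degree at most s^2, s = D1 + D2.  Any s^2 + 1 values
are independent, so if e and X count the edges and the copies of K_{s,s}, the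
expectation of e(1 - X) is at least mn/2q. *)

(** * Unit distance graphs and trace classes *)

Section UnitDistance.
Variable V : finType.
Implicit Types (F G : {set {set V}}) (A B X Z : {set V}) (v y : V).

Definition shatters F X :=
  forall Z, Z \subset X -> exists2 A, A \in F & A :&: X = Z.

(* Lower endpoints of the edges in direction v of the unit distance graph of F. *)
Definition flips F v := [set B : {set V} | [&& v \notin B, B \in F & v |: B \in F]].

Definition del F v := [set A :\ v | A in F].

Lemma delP F v B :
  (B \in del F v) = (v \notin B) && ((B \in F) || (v |: B \in F)).
Proof.
apply/imsetP/andP => [[A AF ->]|[vB /orP[BF|BF]]].
- split; first by rewrite !inE eqxx.
  have [vA|vA] := boolP (v \in A); first by rewrite setD1K // AF orbT.
  suff -> : A :\ v = A by rewrite AF.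
  by apply/setP => w; rewrite !inE; case: eqP => // ->; rewrite (negbTE vA).
- exists B => //; apply/setP => w; rewrite !inE; case: eqP => // ->.
  by rewrite (negbTE vB).
- by exists (v |: B) => //; rewrite setU1K.
Qed.

(** Deleting v merges exactly the pairs [B], [v |: B] with both members in F, one pair for each
    element of [flips F v]. *)
Lemma card_del_flips F v : #|F| = #|del F v| + #|flips F v|.
Proof.
pose F1 := [set A in F | v \notin A].
pose F2 := [set B : {set V} | (v \notin B) && (v |: B \in F)].
have -> : del F v = F1 :|: F2.
  by apply/setP => B; rewrite delP !inE; case: (v \in B); rewrite ?andbF ?andbT.
have -> : flips F v = F1 :&: F2.
  by apply/setP => B; rewrite !inE; case: (v \in B); rewrite ?andbF ?andbT.
rewrite cardsUI -(cardsID [set A : {set V} | v \notin A] F); congr (_ + _).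
  by apply: eq_card => B; rewrite !inE.
have inj : {in F :\: [set A : {set V} | v \notin A] &, injective (fun A => A :\ v)}.
  move=> A B; rewrite !inE !negbK => /andP[vA _] /andP[vB _] E.
  by rewrite -(setD1K vA) E setD1K.
rewrite -(card_in_imset inj); apply: eq_card => B; apply/imsetP/idP.
  by case=> A; rewrite !inE !negbK => /andP[vA AF] ->; rewrite !inE eqxx /= setD1K.
rewrite !inE => /andP[vB BF]; exists (v |: B); last by rewrite setU1K.
by rewrite !inE negbK eqxx /= BF.
Qed.

(** Split the family of edges in direction y along v. Deleting v from such an edge leaves an edge of
    [del F v], and two of them differing only in v form a square of F, hence an edge of
    [flips F v]. *)
Lemma flips_del F v y : y != v ->
  #|flips F y| <= #|flips (del F v) y| + #|flips (flips F v) y|.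
Proof.
move=> yv; have vy : v != y by rewrite eq_sym.
rewrite (card_del_flips _ v); apply: leq_add; apply: subset_leq_card;
  apply/subsetP => B.
  rewrite delP !in_set !delP !in_setU !in_set1 (negbTE yv) (negbTE vy) /= (setUCA [set v]).
  by do ![case: (_ \in _)].
rewrite !inE (negbTE yv) (negbTE vy) /= (setUCA [set v]).
by do ![case: (_ \in _)].
Qed.

Lemma shatters_del F v X : shatters (del F v) X -> shatters F X.
Proof.
move=> sX; have vX : v \notin X.
  apply/negP => vX; have [A] := sX X (subxx _); rewrite delP => /andP[vA _] AX.
  by move: vX; rewrite -AX inE (negbTE vA).
move=> Z /sX[A /imsetP[A' A'F ->] <-]; exists A' => //.
apply/setP => w; rewrite !inE; case: eqP => // ->; by rewrite (negbTE vX) andbF.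
Qed.

(** Members of [flips F v] lie in F both with and without v, so v can be added to any set they
    shatter. This lowers d in the induction below. *)
Lemma shatters_flips F v X :
  shatters (flips F v) X -> (v \notin X) /\ shatters F (v |: X).
Proof.
move=> sX; have vX : v \notin X.
  apply/negP => vX; have [A] := sX X (subxx _); rewrite inE => /andP[vA _] AX.
  by move: vX; rewrite -AX inE (negbTE vA).
split=> // Z ZX.
have [|A AF AX] := sX (Z :\ v).
  apply/subsetP => w; rewrite !inE => /andP[wv wZ].
  by have := subsetP ZX w wZ; rewrite !inE (negbTE wv).
move: AF; rewrite inE => /and3P[vA AF vAF].
have [vZ|vZ] := boolP (v \in Z).
  by exists (v |: A) => //; rewrite -setUIr AX setD1K.
exists A => //; apply/setP => w; have /setP/(_ w) := AX; rewrite !inE.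
case: eqP => [->|] //= _; by rewrite (negbTE vA) (negbTE vZ).
Qed.

(** Induction on the number of covered points: delete a point v, keeping d for [del F v] and using d
    - 1 for [flips F v]. When d = 0, F is empty, since a nonempty family shatters the empty set. *)
Lemma unit_distance_edges d F :
  (forall X, shatters F X -> #|X| < d) ->
  \sum_y #|flips F y| <= d * #|F|.
Proof.
have [n] := ubnP #|cover F|; elim: n d F => // n IH d F; rewrite ltnS => Fn dF.
have [E|[v vF]] := set_0Vmem (cover F).
  rewrite big1 // => y _; apply/eqP; rewrite cards_eq0; apply/eqP/setP => B.
  rewrite !inE; apply/negP => /and3P[_ _ yB].
  suff : y \in cover F by rewrite E inE.
  by apply/bigcupP; exists (y |: B) => //; rewrite !inE eqxx.
case: d dF => [|d] dF.
  case/bigcupP: vF => A AF _.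
  have /dF : shatters F set0.
    by move=> Z; rewrite subset0 => /eqP->; exists A => //; rewrite setI0.
  by rewrite ltn0.
have cov G : (forall B, B \in G -> v \notin B /\ exists2 A, A \in F & B \subset A) ->
    #|cover G| < n.
  move=> GF; apply: leq_trans Fn; apply: proper_card.
  apply/properP; split.
    apply/subsetP => w /bigcupP[B /GF[_ [A AF BA]] wB].
    by apply/bigcupP; exists A => //; apply: (subsetP BA).
  by exists v => //; apply/negP => /bigcupP[B /GF[vB _]]; apply/negP.
have c1 : #|cover (del F v)| < n.
  apply: cov => B /imsetP[A AF ->]; split; first by rewrite !inE eqxx.
  by exists A => //; apply: subD1set.
have c2 : #|cover (flips F v)| < n.
  by apply: cov => B; rewrite inE => /and3P[vB BF _]; split=> //; exists B.
have I1 := IH d.+1 _ c1 (fun X sX => dF X (shatters_del sX)).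
have I2 : \sum_y #|flips (flips F v) y| <= d * #|flips F v|.
  apply: IH c2 _ => X /shatters_flips[vX /dF]; by rewrite cardsU1 vX.
have J : \sum_(y | y != v) #|flips F y| <=
    \sum_(y | y != v) #|flips (del F v) y| + \sum_(y | y != v) #|flips (flips F v) y|.
  by rewrite -big_split /=; apply: leq_sum => y; apply: flips_del.
move: I1 I2; rewrite !(bigD1 (P := xpredT) v) //= => I1 I2.
(* One of the d + 1 copies of [#|flips F v|] pays for the edges in direction v itself. *)
rewrite (card_del_flips F v) mulnDr [_ * #|flips F v|]mulSn.
rewrite addnCA leq_add2l; apply: leq_trans J _; apply: leq_add.
  by apply: leq_trans I1; apply: leq_addl.
by apply: leq_trans I2; apply: leq_addl.
Qed.

End UnitDistance.

Lemma sum_ord_lt c M : c <= M -> \sum_(k < M) (k < c) = c.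
Proof.
move=> cM; rewrite -[RHS]card_ord -sum1_card (big_ord_widen M (fun=> 1)) //.
by rewrite [RHS]big_mkcond /=; apply: eq_bigr => k _; case: (k < c).
Qed.

Lemma subset_of_card (T : finType) (K : {set T}) s :
  s <= #|K| -> exists2 A : {set T}, A \subset K & #|A| = s.
Proof.
move=> sK; have : 0 < #|[set A : {set T} | A \subset K & #|A| == s]|.
  by rewrite cards_draws bin_gt0.
by case/card_gt0P => A; rewrite inE => /andP[AK /eqP cA]; exists A.
Qed.

(** * Trace classes and how single vertices split them *)

Section Incidence.
Variables (U V : finType) (adj : U -> V -> bool).
Implicit Types (S T : {set U}) (X Y W B : {set V}).

Definition nbr x := [set y | adj x y].
Definition conbr y := [set x | adj x y].
Definition trace_class S Y B := [set x in S | nbr x :&: Y == B].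
Definition traces Y := [set nbr x :&: Y | x : U].
(** Measures how far y is from being constant on the trace classes of Y. A set B that is not a trace
    has an empty class and contributes 0. *)
Definition minority S Y y := \sum_(B : {set V})
  minn #|trace_class S Y B :&: conbr y| #|trace_class S Y B :\: conbr y|.
Definition inc S := \sum_y #|S :&: conbr y|.

Lemma sum_card_class S Y : \sum_(B in traces Y) #|trace_class S Y B| = #|S|.
Proof.
rewrite -sum1_card (partition_big (fun x => nbr x :&: Y) (mem (traces Y))) /=.
  by apply: eq_bigr => B _; rewrite -sum1_card; apply: eq_bigl => x; rewrite inE.
by move=> x _; apply: imset_f.
Qed.

(** For y in W, the class of B on [W :\ y] splits into the classes of [B] and [y |: B] on W, so its
    smaller half is the smaller weight at the ends of a unit distance edge. Writing this minimum as
    a number of thresholds k turns the sum into edge counts of the level families [Fk k], each at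
    most [d * #|Fk k|]. *)
Lemma minority_sum d S W :
  (forall X, powerset X \subset traces X -> #|X| < d) ->
  \sum_(y in W) minority S (W :\ y) y <= d * #|S|.
Proof.
move=> vc; pose Fk k := [set A | k < #|trace_class S W A|].
have bound A : #|trace_class S W A| <= #|S|.
  by apply: subset_leq_card; apply/subsetP => x; rewrite inE => /andP[].
have step y B : y \in W ->
    minn #|trace_class S (W :\ y) B :&: conbr y| #|trace_class S (W :\ y) B :\: conbr y|
    <= \sum_(k < #|S|) (B \in flips (Fk k) y).
  move=> yW; have [BW|BW] := boolP (B \subset W :\ y); last first.
    suff -> : trace_class S (W :\ y) B = set0 by rewrite set0I cards0 min0n.
    apply/setP => x; rewrite !inE; apply/negP => /andP[_ /eqP E].
    by case/negP: BW; rewrite -E subsetIr.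
  have yB : y \notin B by apply/negP => /(subsetP BW); rewrite !inE eqxx.
  have -> : trace_class S (W :\ y) B :&: conbr y = trace_class S W (y |: B).
    apply/setP => x; rewrite !inE -andbA; congr (_ && _).
    apply/andP/eqP => [[/eqP E axy]|E]; last split.
    - by rewrite -E setIDA; apply/setP => w; rewrite !inE; case: eqP => // ->;
        rewrite axy yW.
    - apply/eqP; rewrite setIDA E setDUl setDv set0U.
      by apply/setP => w; rewrite !inE; case: eqP => // ->; rewrite (negbTE yB).
    - by have /setP/(_ y) := E; rewrite !inE eqxx yW andbT.
  have -> : trace_class S (W :\ y) B :\: conbr y = trace_class S W B.
    apply/setP => x; rewrite !inE andbCA; congr (_ && _).
    apply/andP/eqP => [[axy /eqP E]|E]; last split.
    - by rewrite -E; apply/setP => w; rewrite !inE; case: eqP => // ->;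
        rewrite (negbTE axy).
    - by apply/negP => axy; case/negP: yB; rewrite -E !inE axy yW.
    - apply/eqP; rewrite -E; apply/setP => w; rewrite !inE; case: eqP => // ->.
      by have /setP/(_ y) := E; rewrite !inE (negbTE yB) => ->; rewrite andbF.
  rewrite -[X in X <= _](@sum_ord_lt _ #|S|); last first.
    by apply: leq_trans (geq_minr _ _) _.
  by apply: leq_sum => k _; rewrite leq_min !inE yB /= andbC.
apply: (@leq_trans (\sum_(k < #|S|) \sum_y #|flips (Fk k) y|)).
  rewrite [X in _ <= X]exchange_big /= [X in _ <= X](bigID (mem W)) /=.
  apply: leq_trans (leq_addr _ _); apply: leq_sum => y yW.
  apply: (@leq_trans (\sum_(B : {set V}) \sum_(k < #|S|) (B \in flips (Fk k) y))).
    by apply: leq_sum => B _; apply: step.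
  rewrite exchange_big /=; apply: leq_sum => k _.
  by rewrite -(sum1_card (mem (flips (Fk k) y))) [X in _ <= X]big_mkcond; apply: leq_sum => B _; case: ifP.
apply: (@leq_trans (\sum_(k < #|S|) d * #|Fk k|)).
  apply: leq_sum => k _; apply: unit_distance_edges => X sX; apply: vc.
  (* Members of [Fk k] have nonempty classes, so they are traces on W; what they shatter lies in W
     and is shattered by the traces. *)
  have XW : X \subset W.
    have [A] := sX X (subxx _); rewrite inE => kA AX.
    have /card_gt0P[x] : 0 < #|trace_class S W A| by apply: leq_ltn_trans kA.
    by rewrite inE => /andP[_ /eqP E]; rewrite -AX -E setIAC subsetIr.
  apply/subsetP => Z; rewrite inE => /sX[A]; rewrite inE => kA AX.
  have /card_gt0P[x] : 0 < #|trace_class S W A| by apply: leq_ltn_trans kA.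
  rewrite inE => /andP[_ /eqP E]; apply/imsetP; exists x => //.
  by rewrite -AX -E -setIA (setIidPr XW).
rewrite -big_distrr leq_mul2l; apply/orP; right.
(* The level sizes add up to the class sizes, and these to [#|S|]. *)
rewrite -[X in _ <= X](sum_card_class S W).
rewrite (eq_bigr (fun k : 'I_#|S| => \sum_A (k < #|trace_class S W A| : nat))); last first.
  by move=> k _; rewrite -(sum1_card (mem (Fk k))) big_mkcond; apply: eq_bigr => A _; rewrite inE; case: ifP.
rewrite exchange_big /= [X in _ <= X]big_mkcond; apply: leq_sum => A _.
rewrite sum_ord_lt //; case: ifPn => // nA; rewrite leqn0 cards_eq0.
apply/eqP/setP => x; rewrite !inE; apply/negP => /andP[_ /eqP E].
by case/negP: nA; rewrite -E; apply: imset_f.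
Qed.

(** All points of a trace class of Y agree on their adjacency to y. *)
Lemma minority_mem S Y y : y \in Y -> minority S Y y = 0.
Proof.
move=> yY; apply: big1 => B _; have [yB|yB] := boolP (y \in B).
  suff -> : trace_class S Y B :\: conbr y = set0 by rewrite cards0 minn0.
  apply/setP => x; rewrite !inE; apply/negP => /and3P[/negP axy _ /eqP E].
  by apply: axy; move: yB; rewrite -E !inE => /andP[].
suff -> : trace_class S Y B :&: conbr y = set0 by rewrite cards0 min0n.
apply/setP => x; rewrite !inE; apply/negP => /andP[/andP[_ /eqP E] axy].
by case/negP: yB; rewrite -E !inE axy.
Qed.

(** Averaging over all Y of size z: adding y to Y gives a set W of size z + 1 with a marked point,
    to which the previous bound applies. If V has at most z points, Y = V has no minority at all. *)
Lemma small_minority d S z :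
  (forall X, powerset X \subset traces X -> #|X| < d) ->
  exists2 Y : {set V}, #|Y| <= z & z * (\sum_y minority S Y y) <= d * #|S| * #|V|.
Proof.
move=> vc; have [Vz|zV] := leqP #|V| z.
  exists setT; rewrite ?cardsT // big1 ?muln0 // => y _.
  by rewrite minority_mem ?inE.
have [/existsP[Y /andP[/eqP cY HY]]|no] := boolP [exists Y : {set V},
    (#|Y| == z) && (z * (\sum_y minority S Y y) <= d * #|S| * #|V|)].
  by exists Y; rewrite ?cY.
exfalso.
have reindex : \sum_(Y : {set V} | #|Y| == z) \sum_y minority S Y y =
    \sum_(W : {set V} | #|W| == z.+1) \sum_(y in W) minority S (W :\ y) y.
  transitivity (\sum_(Y : {set V} | #|Y| == z) \sum_(y | y \notin Y) minority S Y y).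
    apply: eq_bigr => Y _; rewrite (bigID (mem Y)) /= big1 //.
    by move=> y; apply: minority_mem.
  rewrite [LHS]pair_big_dep [RHS]pair_big_dep /=.
  rewrite (reindex_onto (fun p : {set V} * V => (p.1 :\ p.2, p.2)) (fun p => (p.2 |: p.1, p.2))) /=.
    apply: eq_bigl => -[W y] /=; rewrite !inE eqxx /= andbT xpair_eqE eqxx andbT.
    have [yW|yW] := boolP (y \in W).
      by rewrite setD1K // eqxx andbT (cardsD1 y W) yW add1n eqSS andbT.
    rewrite andbF; apply/negP => /andP[_ /eqP E].
    by case/negP: yW; rewrite -E !inE eqxx.
  by move=> [Y y] /andP[_ yY] /=; rewrite setU1K.
have up : \sum_(W : {set V} | #|W| == z.+1) \sum_(y in W) minority S (W :\ y) y
    <= 'C(#|V|, z.+1) * (d * #|S|).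
  rewrite -(card_draws V z.+1) -sum_nat_cond_const.
  by apply: leq_sum => W _; apply: minority_sum.
have lo : 'C(#|V|, z) * (d * #|S| * #|V|).+1 <=
    z * \sum_(Y : {set V} | #|Y| == z) \sum_y minority S Y y.
  rewrite -(card_draws V z) -sum_nat_cond_const big_distrr /=.
  apply: leq_sum => Y cY; rewrite ltnNge; apply/negP => HY.
  by move/existsP: no; apply; exists Y; rewrite cY.
have B0 : 0 < 'C(#|V|, z) by rewrite bin_gt0 ltnW.
(* The ratio of the two binomials is (n - z)/(z + 1), at most n/z for z > 0; the strict excess for
   every Y in [lo] gives the contradiction. *)
have := mul_bin_left #|V| z; move: lo up; rewrite reindex.
move: #|V| #|S| 'C(#|V|, z) 'C(#|V|, z.+1) (\sum_(W : {set V} | _) _) B0 zV.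
move=> n k c b t B0 zV lo up e; have {lo up} : c * (d * k * n).+1 <= z * b * (d * k).
  by apply: (leq_trans lo); rewrite -mulnA leq_mul2l up orbT.
have zb : z * b <= n * c.
  by apply: (@leq_trans (z.+1 * b)); rewrite ?leq_mul2r ?leqnSn ?orbT // e leq_mul2r leq_subr orbT.
apply/negP; rewrite -ltnNge; apply: (@leq_ltn_trans (n * c * (d * k))).
  by rewrite leq_mul2r zb orbT.
by rewrite (mulnC n) -mulnA (mulnC n) ltn_pmul2l.
Qed.

End Incidence.

(** * Incidences in graphs without K_{s,s} *)

Section KFree.
Variables (U V : finType) (adj : U -> V -> bool).
Implicit Types (S T : {set U}) (X Y W B : {set V}).

Definition Kfree s := forall (A : {set U}) B, #|A| = s -> #|B| = s ->
  ~ (forall x y, x \in A -> y \in B -> adj x y).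

Lemma incD S T : T \subset S -> inc adj S = inc adj (S :\: T) + inc adj T.
Proof.
move=> TS; rewrite /inc -big_split /=; apply: eq_bigr => y _.
rewrite -(cardsID T) addnC setIDAC setIAC; congr (_ + #|_ :&: _|).
exact/setIidPr.
Qed.

(** The minimum of two numbers is superadditive. *)
Lemma minorityD S T Y y : T \subset S ->
  minority adj (S :\: T) Y y + minority adj T Y y <= minority adj S Y y.
Proof.
move=> TS; rewrite /minority -big_split /=; apply: leq_sum => B _.
set C := trace_class adj S Y B.
have -> : trace_class adj (S :\: T) Y B = C :\: T.
  by apply/setP => x; rewrite !inE andbA.
have -> : trace_class adj T Y B = C :&: T.
  apply/setP => x; rewrite !inE andbAC; congr (_ && _).
  by case xT: (x \in T); rewrite ?andbF // (subsetP TS).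
have part (E : {set U}) :
    #|C :&: E| = #|(C :\: T) :&: E| + #|(C :&: T) :&: E|.
  by rewrite -(cardsID T (C :&: E)) addnC setIDAC setIAC.
by rewrite !(setDE _ (conbr _ _)) !part; lia.
Qed.

(** As long as S has more than s points per trace, some class contains a block A of s points, which
    is removed. The term [s * #|S'|] stands on the left to avoid subtraction: each block costs s * s
    besides its minorities. *)
Lemma block_reduction s S Y : 0 < s -> Kfree s ->
  exists2 S' : {set U}, #|S'| <= s * #|traces adj Y| &
    inc adj S + s * #|S'| <= inc adj S' + s * (\sum_y minority adj S Y y) + s * #|S|.
Proof.
move=> s0 Kf; have [n] := ubnP #|S|; elim: n S => // n IH S; rewrite ltnS => Sn.
have [small|large] := leqP #|S| (s * #|traces adj Y|).
  by exists S => //; rewrite -addnA leq_add2l leq_addl.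
have [/existsP[B BS]|no] := boolP [exists B, s <= #|trace_class adj S Y B|]; last first.
  suff : #|S| <= s * #|traces adj Y| by rewrite leqNgt large.
  rewrite -(sum_card_class adj S Y) mulnC -sum_nat_const; apply: leq_sum => B _.
  by rewrite leqNgt; apply/negP => /ltnW BS; case/existsP: no; exists B.
have [A AB cA] := subset_of_card BS.
have AS : A \subset S.
  by apply: subset_trans AB _; apply/subsetP => x; rewrite inE => /andP[].
have cS : #|S| = #|S :\: A| + s.
  by rewrite -(cardsID A) (setIidPr AS) cA addnC.
have [|S' cS' HS'] := IH (S :\: A).
  by apply: leq_trans Sn; rewrite cS -addn1 leq_add2l.
exists S' => //; rewrite (incD AS) cS.
have minA y : minority adj A Y y >= minn #|A :&: conbr adj y| #|A :\: conbr adj y|.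
  rewrite /minority (bigD1 B) //=; apply: leq_trans (leq_addr _ _).
  suff -> : trace_class adj A Y B = A by [].
  apply/setP => x; rewrite !inE; case xA: (x \in A) => //=.
  by have := subsetP AB x xA; rewrite !inE => /andP[].
have minS : \sum_y minority adj (S :\: A) Y y + \sum_y minority adj A Y y
    <= \sum_y minority adj S Y y.
  by rewrite -big_split; apply: leq_sum => y _; apply: minorityD.
pose full := [set y | A \subset conbr adj y].
have cfull : #|full| <= s.
  rewrite leqNgt; apply/negP => /ltnW /subset_of_card[B' B'f cB'].
  apply: (Kf A B') => // x y xA /(subsetP B'f); rewrite inE => /subsetP/(_ x xA).
  by rewrite inE.
(* A vertex adjacent to all of A contributes s, and there are at most s of these; any other vertex
   meeting A splits it, so its minority is at least 1 and pays for its at most s incidences. *)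
have incA : inc adj A <= s * (\sum_y minority adj A Y y) + s * s.
  apply: (@leq_trans (\sum_y (s * minority adj A Y y + s * (y \in full)))).
    apply: leq_sum => y _; rewrite inE; have [Ay|Ay] := boolP (A \subset _).
      by rewrite muln1 (setIidPl Ay) cA leq_addl.
    rewrite muln0 addn0; have [->|[x xA]] := set_0Vmem (A :&: conbr adj y).
      by rewrite cards0.
    apply: (@leq_trans (s * 1)); first by rewrite muln1 -cA subset_leq_card ?subsetIl.
    rewrite leq_mul2l; apply/orP; right; apply: leq_trans (minA y).
    rewrite leq_min; apply/andP; split; first by apply/card_gt0P; exists x.
    by case/subsetPn: Ay => x' x'A x'y; apply/card_gt0P; exists x'; rewrite inE x'y.
  rewrite big_split -!big_distrr /= leq_add2l leq_mul2l; apply/orP; right.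
  apply: leq_trans cfull; rewrite -sum1_card [X in _ <= X]big_mkcond.
  by apply: leq_sum => y _; case: ifP.
move: HS' incA minS; rewrite mulnDr.
move: (s * s) (inc adj A) (inc adj (S :\: A)) (inc adj S') => a b c e.
move: (\sum_y minority adj (S :\: A) Y y) (\sum_y minority adj A Y y) => M1 M2.
move: (\sum_y minority adj S Y y) => M H1 H2 H3.
have H4 : s * M1 + s * M2 <= s * M by rewrite -mulnDr leq_mul2l H3 orbT.
move: H1 H2 H4; move: (s * #|S'|) (s * #|S :\: A|) (s * M) (s * M1) (s * M2); lia.
Qed.

(** Induction on the scale i: a set Y of at most 2^i vertices with small total minority reduces S to
    a set S' of the previous scale. The [s * #|S'|] from the induction cancels against the one in
    the block reduction. *)
Lemma dyadic_incidence a D d s :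
  0 < s -> 1 < D -> Kfree s ->
  (forall Y, #|traces adj Y| <= a * #|Y|.+1 ^ D) ->
  (forall X, powerset X \subset traces adj X -> #|X| < d) ->
  forall i S, #|S| <= s * a * 2 ^ D * 2 ^ (i * D) ->
  inc adj S <= (s * d).+1 * (s * a * 2 ^ D) * 2 ^ D * 2 ^ (i * D.-1) * #|V| + s * #|S|.
Proof.
move=> s0 D1 Kf sh vc; set K := s * a * 2 ^ D.
elim=> [|i IH] S cS.
  apply: leq_trans (leq_addr _ _); rewrite mul0n muln1 in cS *.
  apply: (@leq_trans (K * #|V|)).
    rewrite mulnC -sum_nat_const; apply: leq_sum => y _; apply: leq_trans cS.
    by rewrite subset_leq_card // subsetIl.
  rewrite leq_mul2r; apply/orP; right.
  by rewrite muln1 -mulnA mulnCA leq_pmulr // muln_gt0 expn_gt0.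
have [Y cY mY] := small_minority S (2 ^ i) vc.
have [S' cS' HS'] := block_reduction S Y s0 Kf.
have {}cS' : #|S'| <= K * 2 ^ (i * D).
  apply: (leq_trans cS'); rewrite /K -!mulnA leq_mul2l; apply/orP; right.
  apply: (leq_trans (sh Y)); rewrite leq_mul2l; apply/orP; right.
  (* The factor 2^D in K absorbs the successor, as 2^i + 1 <= 2 * 2^i. *)
  rewrite expnM -expnMn leq_exp2r; last by apply: leq_trans D1.
  by rewrite mul2n -addnn -add1n leq_add // expn_gt0.
have IH' := IH _ cS'; clearbody K.
pose P := 2 ^ (i * D.-1); pose E := K * 2 ^ D * P * #|V|.
(* Since D > 1 the main term at least doubles with i. The step then closes: the new loss is sd * E,
   the induction gives (sd + 1) * E, and together they are at most (sd + 1) * 2E. *)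
have P2 : 2 * P <= 2 ^ (i.+1 * D.-1).
  rewrite /P -expnS leq_exp2l // mulSn -add1n leq_add2r.
  by rewrite -ltnS prednK // ltnW.
have powE : 2 ^ (i.+1 * D) = 2 ^ i * (2 ^ D * P).
  by rewrite /P -!expnD; congr (2 ^ _); case: D D1 {K sh IH cS cS' IH' P E P2} => // D _ /=; lia.
have ME : \sum_y minority adj S Y y <= d * E.
  rewrite -(@leq_pmul2l (2 ^ i)) ?expn_gt0 //; apply: (leq_trans mY).
  apply: (@leq_trans (d * (K * 2 ^ (i.+1 * D)) * #|V|)).
    by rewrite leq_mul2r leq_mul2l cS !orbT.
  by rewrite powE /E; apply/eq_leq; move: (2 ^ i) (2 ^ D) => x y; ring.
have goalE : (s * d).+1 * (2 * E) <=
    (s * d).+1 * K * 2 ^ D * 2 ^ (i.+1 * D.-1) * #|V|.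
  rewrite -!mulnA leq_mul2l; apply/orP; right; rewrite /E.
  have -> : 2 * (K * 2 ^ D * P * #|V|) = K * (2 ^ D * (2 * P * #|V|)).
    by move: (2 ^ D) => x; ring.
  by rewrite !leq_mul2l leq_mul2r P2 !orbT.
have IHE : (s * d).+1 * K * 2 ^ D * 2 ^ (i * D.-1) * #|V| = (s * d).+1 * E.
  by rewrite /E -!mulnA.
rewrite IHE in IH'; apply: leq_trans (leq_add goalE (leqnn _)).
have sM : s * (\sum_y minority adj S Y y) <= s * d * E.
  by rewrite -mulnA leq_mul2l ME orbT.
move: HS' IH' sM; rewrite !mulSn mulnCA.
move: (s * (\sum_y _)) (s * d * E) (s * #|S'|) (s * #|S|) (inc adj S) (inc adj S').
by move=> u v w x y z; lia.
Qed.

End KFree.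

(** * Zero patterns of polynomials *)

Section Degree.
Local Open Scope ring_scope.
Variable F : fieldType.

Lemma msizeM_leS n (p q : {mpoly F[n]}) a b :
  (msize p <= a.+1 -> msize q <= b.+1 -> msize (p * q) <= (a + b).+1)%N.
Proof.
have [->|p0] := eqVneq p 0; first by rewrite mul0r msize0.
have [->|q0] := eqVneq q 0; first by rewrite mulr0 msize0.
move=> pa qb; rewrite msizeM // -subn1 leq_subLR add1n -addnS -addSn.
exact: leq_add.
Qed.

Lemma msize_prod_le n (I : Type) (r : seq I) (P : pred I)
    (q : I -> {mpoly F[n]}) (d : I -> nat) :
  (forall i, P i -> msize (q i) <= (d i).+1)%N ->
  (msize (\prod_(i <- r | P i) q i) <= (\sum_(i <- r | P i) d i).+1)%N.
Proof.
move=> qd; elim/big_rec2: _ => [|i a p Pi pa]; first by rewrite msize1.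
exact: msizeM_leS (qd _ Pi) pa.
Qed.

Lemma msize_comp_affine n D (f : {mpoly F[n]}) (q : n.-tuple {mpoly F[D]}) :
  (forall i, msize (tnth q i) <= 2)%N -> (msize (f \mPo q) <= msize f)%N.
Proof.
move=> q2; rewrite comp_mpolyE; apply: (leq_trans (msize_sum _ _ _)).
apply/bigmax_leqP_seq => m mf _; apply: (leq_trans (msizeZ_le _ _)).
apply: leq_trans (msize_mdeg_lt mf); rewrite mdegE.
apply: msize_prod_le => i _.
elim: (m i) => [|k IH]; first by rewrite expr0 msize1.
by rewrite exprS; exact: (@msizeM_leS _ _ _ 1 k (q2 i) IH).
Qed.

Lemma msizeU_le n (i : 'I_n) : (msize ('X_i : {mpoly F[n]}) <= 2)%N.
Proof. by rewrite msizeX mdeg1. Qed.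

Lemma msizeC_le n (c : F) : (msize (c%:MP : {mpoly F[n]}) <= 2)%N.
Proof. by rewrite msizeC; case: (c != 0). Qed.

Definition evall D1 D2 (f : {mpoly F[D1 + D2]}) (y : 'rV[F]_D2) : {mpoly F[D1]} :=
  f \mPo [tuple match split i with inl j => 'X_j | inr j => (y 0 j)%:MP end | i < D1 + D2].

Definition evalr D1 D2 (f : {mpoly F[D1 + D2]}) (x : 'rV[F]_D1) : {mpoly F[D2]} :=
  f \mPo [tuple match split i with inl j => (x 0 j)%:MP | inr j => 'X_j end | i < D1 + D2].

Lemma msize_evall D1 D2 (f : {mpoly F[D1 + D2]}) y : (msize (evall f y) <= msize f)%N.
Proof.
apply: msize_comp_affine => i; rewrite tnth_mktuple.
by case: split => j; rewrite ?msizeU_le ?msizeC_le.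
Qed.

Lemma msize_evalr D1 D2 (f : {mpoly F[D1 + D2]}) x : (msize (evalr f x) <= msize f)%N.
Proof.
apply: msize_comp_affine => i; rewrite tnth_mktuple.
by case: split => j; rewrite ?msizeU_le ?msizeC_le.
Qed.

Lemma evallE D1 D2 (f : {mpoly F[D1 + D2]}) (x : 'rV_D1) y :
  (evall f y).@[x 0] = f.@[row_mx x y 0].
Proof.
rewrite comp_mpoly_meval; apply: meval_eq => i; rewrite tnth_mktuple mxE.
by case: split => j; rewrite ?mevalXU ?mevalC.
Qed.

Lemma evalrE D1 D2 (f : {mpoly F[D1 + D2]}) x (y : 'rV_D2) :
  (evalr f x).@[y 0] = f.@[row_mx x y 0].
Proof.
rewrite comp_mpoly_meval; apply: meval_eq => i; rewrite tnth_mktuple mxE.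
by case: split => j; rewrite ?mevalXU ?mevalC.
Qed.

Lemma card_bmultinom D k : (#|{: 'X_{1..D < k}}| <= k ^ D)%N.
Proof.
case: k => [|k].
  by rewrite leqNgt; apply/negP => /(leq_ltn_trans (leq0n _)) /card_gt0P[m _]; have := bmdeg m.
rewrite -[X in (X ^ _)%N]card_ord -[D in X in (_ <= X)%N]card_ord -card_ffun.
apply: (@leq_card _ _ (fun m : 'X_{1..D < k.+1} => [ffun i : 'I_D => (inord (m i) : 'I_k.+1)])).
move=> m1 m2 /ffunP E; apply/val_inj/mnmP => i; have := E i; rewrite !ffunE.
have lt (m : 'X_{1..D < k.+1}) : (m i < k.+1)%N.
  by apply: leq_ltn_trans (bmdeg m); rewrite mdegE (bigD1 i) // leq_addr.
by move/(congr1 val); rewrite /= !inordK.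
Qed.

(** Attach to each pattern Z i a witness point and the product [h i] of the polynomials of H outside
    Z i. Then [h i] is nonzero at the k-th witness exactly when Z k lies in Z i, so the [h i] are
    independent in the space of polynomials of degree at most t|H|. *)
Lemma zero_patterns D t (J X : finType) (g : J -> {mpoly F[D]})
    (pt : X -> 'I_D -> F) (H : {set J}) :
  (forall j, msize (g j) <= t.+1)%N ->
  (#|[set [set j in H | (g j).@[pt x] == 0%R] | x : X]%SET| <= (t * #|H|).+1 ^ D)%N.
Proof.
move=> gt; set Pt := (imset _ _); pose Z (i : 'I_#|Pt|) : {set J} := enum_val i.
have ex i : exists x : X, Z i == [set j in H | (g j).@[pt x] == 0]%SET.
  by have /imsetP[x _ E] := enum_valP i; exists x; rewrite /Z E.
pose xx i := xchoose (ex i).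
have xxE i : Z i = [set j in H | (g j).@[pt (xx i)] == 0]%SET by apply/eqP/(xchooseP (ex i)).
pose h i := \prod_(j in H :\: Z i) g j.
have hE i k : ((h i).@[pt (xx k)] != 0) = (Z k \subset Z i).
  rewrite /h rmorph_prod /=; apply/prodf_neq0/subsetP => [nz j jk|sub j].
    have : j \in H by move: jk; rewrite xxE inE => /andP[].
    move=> jH; apply: contraLR jk => ji; rewrite xxE inE jH /=.
    by apply: nz; rewrite !inE ji.
  rewrite !inE => /andP[ji jH]; apply: contra ji => /eqP gz.
  by apply: sub; rewrite xxE inE jH gz eqxx.
pose K := (t * #|H|).+1.
have hsz i : (msize (h i) <= K)%N.
  apply: leq_trans (@msize_prod_le _ _ _ _ _ (fun=> t) (fun j _ => gt j)) _.
  rewrite sum_nat_const ltnS mulnC leq_mul2l subset_leq_card ?orbT //.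
  by rewrite subDset subsetUr.
pose M : 'M[F]_#|Pt| := \matrix_(i, k) (h i).@[pt (xx k)].
pose B := #|{: 'X_{1..D < K}}|.
pose C : 'M[F]_(#|Pt|, B) := \matrix_(i, b) (h i)@_(enum_val b : 'X_{1..D < K}).
pose E : 'M[F]_(B, #|Pt|) :=
  \matrix_(b, k) ('X_[F, (enum_val b : 'X_{1..D < K})]).@[pt (xx k)].
(* Expanding in monomials factors M through the space of bounded degree polynomials, whose dimension
   bounds its rank. *)
have ME : M = C *m E.
  apply/matrixP => i k; rewrite !mxE [in LHS](mpolywE (hsz i)) raddf_sum /=.
  rewrite (reindex (enum_val : 'I_B -> 'X_{1..D < K})) /=; last first.
    by apply: onW_bij; apply: enum_val_bij.
  by apply: eq_bigr => b _; rewrite mevalZ !mxE.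
apply: leq_trans (card_bmultinom D K); rewrite -/B.
suff /eqP <- : row_free M by rewrite ME mulmx_max_rank.
(* The matrix is triangular for the inclusion order of zero patterns. *)
apply: inj_row_free => v vM; apply/eqP/negP => /negP /rV0Pn[k0 vk0].
(* With Z k largest in the support of v, any other i in the support has Z k not inside Z i, so only
   the diagonal term survives in column k. *)
case: (@arg_maxnP _ k0 (fun k => v 0 k != 0) (fun k => #|Z k|) vk0) => k vk kmax.
have /matrixP/(_ 0 k) := vM; rewrite !mxE (bigD1 k) //= big1 => [/eqP|i ik].
  by rewrite addr0 mxE mulf_eq0 (negbTE vk) /=; apply/negP; rewrite hE.
rewrite mxE; apply/eqP; rewrite mulf_eq0 -implyNb; apply/implyP => vi.
apply/negPn; rewrite hE; apply/negP => sub.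
case/eqP: ik; apply: enum_val_inj; apply/esym/eqP; rewrite eqEcard sub.
exact: kmax.
Qed.

End Degree.

Lemma exp_beats_poly a D : exists d, a * d.+1 ^ D < 2 ^ d.
Proof.
(* With d + 1 = 2^e the claim follows from a + eD < 2^e; for e = 2f the right side is at least (f +
   1)^2. *)
pose f := a + D + D + 2; pose e := f + f.
exists (2 ^ e).-1; rewrite prednK ?expn_gt0 // -expnM.
apply: (@leq_trans (2 ^ a * 2 ^ (e * D))).
  by rewrite ltn_pmul2r ?expn_gt0 // ltn_expl.
rewrite -expnD leq_exp2l // -ltnS prednK ?expn_gt0 // /e expnD.
have H := ltn_expl f (ltnSn 1); apply: (@leq_trans (f.+1 * f.+1)); last exact: leq_mul.
by rewrite /f; nia.
Qed.

Lemma bf_eval_eq k (v w : 'I_k -> bool) Phi : v =1 w -> bf_eval v Phi = bf_eval w Phi.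
Proof. by move=> vw; elim: Phi => //= [A -> | A -> B -> | A -> B ->]. Qed.

(** * Trace counts of algebraic graphs and nearly trivial neighbourhoods *)

Section Side.
Variables (U V : finType) (adj : U -> V -> bool).

(** A larger shattered set would contain a d-subset with all 2^d traces. *)
Lemma shattered_lt a D d :
  (forall Y, #|traces adj Y| <= a * #|Y|.+1 ^ D) -> a * d.+1 ^ D < 2 ^ d ->
  forall X : {set V}, powerset X \subset traces adj X -> #|X| < d.
Proof.
move=> sh ad X pX; rewrite ltnNge; apply/negP => /subset_of_card[Y YX cY].
suff : 2 ^ d <= a * d.+1 ^ D by rewrite leqNgt ad.
rewrite -cY; apply: leq_trans (sh Y); rewrite -card_powerset; apply: subset_leq_card.
apply/subsetP => Z; rewrite inE => ZY.
have /(subsetP pX)/imsetP[x _ E] : Z \in powerset X by rewrite inE (subset_trans ZY).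
apply/imsetP; exists x => //; rewrite -(setIidPl ZY) E -setIA; congr (_ :&: _).
exact/setIidPr.
Qed.

(** Fewer than s vertices can be co-bounded when U is large: s of them would share all but s * h
    points of U, leaving s common neighbours. All others have degree at most h. *)
Lemma near_trivial_incidence h s :
  (forall y, #|conbr adj y| <= h \/ #|~: conbr adj y| <= h) -> Kfree adj s ->
  inc adj setT <= (s + s * h + h) * #|V| + s * #|U|.
Proof.
move=> tri Kf; have [small|large] := leqP #|U| (s + s * h).
  apply: leq_trans (leq_addr _ _); rewrite mulnC -sum_nat_const; apply: leq_sum => y _.
  by apply: leq_trans (leq_addr _ _); apply: leq_trans small; apply: max_card.
pose T := [set y | #|~: conbr adj y| <= h].
have cT : #|T| <= s.
  rewrite leqNgt; apply/negP => /ltnW/subset_of_card[B BT cB].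
  pose A0 := \bigcap_(y in B) conbr adj y.
  have cA0 : #|~: A0| <= s * h.
    rewrite /A0 setC_bigcap -cB -sum_nat_const.
    apply: (@leq_trans (\sum_(y in B) #|~: conbr adj y|)); last first.
      by apply: leq_sum => y /(subsetP BT); rewrite inE.
    elim/big_rec2: _ => [|y n W _ nW]; first by rewrite cards0.
    by rewrite cardsU; apply: leq_trans (leq_subr _ _) _; rewrite leq_add2l.
  have /subset_of_card[A AA cA] : s <= #|A0|.
    move: (cardsC A0) large cA0; lia.
  apply: (Kf A B) => // x y xA yB.
  by have /bigcapP/(_ y yB) := subsetP AA x xA; rewrite inE.
rewrite /inc (bigID (mem T)) /= addnC; apply: leq_add.
  apply: (@leq_trans (\sum_(y : V) (s + s * h + h))); last by rewrite sum_nat_const mulnC.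
  rewrite big_mkcond; apply: leq_sum => y _; case: ifPn => //.
  rewrite inE => yT; rewrite setTI; case: (tri y) => // [le|]; last by rewrite (negbTE yT).
  by apply: leq_trans le _; rewrite leq_addl.
apply: (@leq_trans (\sum_(y in T) #|U|)); last by rewrite sum_nat_const leq_mul2r cT orbT.
by apply: leq_sum => y _; apply: max_card.
Qed.

Variables (F : fieldType) (D k t : nat) (pt : U -> 'rV[F]_D).
Variables (g : 'I_k -> V -> {mpoly F[D]}) (Phi : bool_formula k).
Hypothesis kt : k <= t.
Hypothesis gt : forall i y, msize (g i y) <= t.+1.
Hypothesis adjE : forall x y,
  adj x y = bf_eval (fun i => ((g i y).@[pt x 0] == 0)%R) Phi.

(** The trace on Y of a point is determined by which of the k|Y| polynomials attached to Y vanish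
    there. *)
Lemma traces_algebraic Y : #|traces adj Y| <= (t * t).+1 ^ D * #|Y|.+1 ^ D.
Proof.
pose H := [set j : 'I_k * V | j.2 \in Y].
pose pat x := [set j in H | ((g j.1 j.2).@[pt x 0] == 0)%R].
pose tr (Z : {set 'I_k * V}) := [set y in Y | bf_eval (fun i => (i, y) \in Z) Phi].
have -> : traces adj Y = tr @: [set pat x | x : U].
  rewrite -imset_comp; apply: eq_imset => x; apply/setP => y; rewrite !inE andbC.
  case yY: (y \in Y) => //=; rewrite adjE; apply: bf_eval_eq => i.
  by rewrite !inE /= yY.
apply: (leq_trans (leq_imset_card _ _)).
have := @zero_patterns F D t _ U (fun j : 'I_k * V => g j.1 j.2) (fun x => pt x 0%R) H
  (fun j => gt j.1 j.2).
move/leq_trans; apply; rewrite -expnMn.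
have -> : H = setX setT Y by apply/setP => j; rewrite !inE.
rewrite cardsX cardsT card_ord; elim: (D) => // e IH; rewrite !expnS leq_mul //.
apply: (@leq_trans (t * (t * #|Y|)).+1); last by nia.
by rewrite ltnS leq_mul2l leq_mul2r kt !orbT.
Qed.

End Side.

(** * One-dimensional neighbourhoods *)

Section Line.
Variable F : fieldType.

Lemma mpoly1_poly (p : {mpoly F[1]}) : exists2 q : {poly F},
  (size q <= msize p)%N & forall x : 'rV[F]_1, q.[x 0%R 0%R]%R = p.@[x 0%R].
Proof.
exists (\sum_(m <- msupp p) p@_m *: 'X^(m ord0))%R.
  apply: (leq_trans (size_sum _ _ _)); apply/bigmax_leqP_seq => m mp _.
  apply: (leq_trans (size_scale_leq _ _)); rewrite size_polyXn.
  by apply: leq_trans (msize_mdeg_lt mp); rewrite mdegE big_ord1.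
move=> x; rewrite mevalE horner_sum; apply: eq_bigr => m _.
by rewrite hornerZ hornerXn big_ord1.
Qed.

Lemma zeros_line (U : finType) (pt : U -> 'rV[F]_1) (p : {mpoly F[1]}) t :
  injective pt -> (msize p <= t.+1)%N ->
  let Z := [set u | (p.@[pt u 0] == 0)%R] in Z = setT \/ (#|Z| <= t)%N.
Proof.
move=> inj pt1 Z; have [q qp qE] := mpoly1_poly p.
have [q0|q0] := eqVneq q 0%R.
  by left; apply/setP => u; rewrite !inE -qE q0 horner0 eqxx.
right; rewrite cardE -(size_map (fun u => pt u 0%R 0%R)) -ltnS.
apply: leq_trans pt1; apply: leq_trans qp; apply: max_poly_roots => //.
  by apply/allP => _ /mapP[u uZ ->]; move: uZ; rewrite mem_enum inE -qE.
rewrite map_inj_uniq ?enum_uniq // => u v E; apply: inj; apply/rowP => i.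
by rewrite !ord1.
Qed.

(** Outside the union E of the zero sets that are not everything, each equation has a constant truth
    value, hence so has the formula; E has at most k * t points. *)
Lemma near_trivial_line (U V : finType) (adj : U -> V -> bool) k t
    (pt : U -> 'rV[F]_1) (g : 'I_k -> V -> {mpoly F[1]}) (Phi : bool_formula k) :
  injective pt -> k <= t -> (forall i y, msize (g i y) <= t.+1) ->
  (forall x y, adj x y = bf_eval (fun i => ((g i y).@[pt x 0] == 0)%R) Phi) ->
  forall y, #|conbr adj y| <= t * t \/ #|~: conbr adj y| <= t * t.
Proof.
move=> inj kt gt adjE y.
pose Z i := [set u | ((g i y).@[pt u 0] == 0)%R].
pose E := \bigcup_(i | Z i != setT) Z i.
have cE : #|E| <= t * t.
  apply: (@leq_trans (k * t)); last by rewrite leq_mul2r kt orbT.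
  apply: (@leq_trans (\sum_(i : 'I_k | Z i != setT) t)); last first.
    rewrite -[X in X * _]card_ord -sum_nat_const big_mkcond.
    by apply: leq_sum => i _; case: ifP.
  rewrite /E; elim/big_rec2: _ => [|i n W Zi nW]; first by rewrite cards0.
  rewrite cardsU; apply: leq_trans (leq_subr _ _) _; apply: leq_add => //.
  by have [E1|//] := zeros_line inj (gt i y); rewrite /Z E1 eqxx in Zi.
have same x x' : x \notin E -> x' \notin E -> adj x y = adj x' y.
  move=> xE x'E; rewrite !adjE; apply: bf_eval_eq => i.
  have [ZT|ZT] := eqVneq (Z i) setT.
    by have /setP E1 := ZT; have := E1 x; have := E1 x'; rewrite !inE => -> ->.
  have nz u : u \notin E -> ((g i y).@[pt u 0] == 0)%R = false.
    by apply: contraNF => gz; apply/bigcupP; exists i => //; rewrite inE.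
  by rewrite !nz.
have [/existsP[x /andP[xE nx]]|no] := boolP [exists x, (x \notin E) && ~~ adj x y].
  left; apply: leq_trans cE; apply: subset_leq_card; apply/subsetP => x'.
  by rewrite inE; apply: contraLR => x'E; rewrite (same _ _ x'E xE).
right; apply: leq_trans cE; apply: subset_leq_card; apply/subsetP => x'.
by rewrite !inE; apply: contraLR => x'E; apply/negP => nx; case/existsP: no; exists x'; rewrite x'E.
Qed.

End Line.

(** * The upper bound *)

Local Open Scope ring_scope.

Section Powers.
Variable R : realType.

Lemma exponent_ge0 D : (0 < D)%N -> 0 <= 1 - D%:R^-1 :> R.
Proof. by move=> D0; rewrite subr_ge0 invf_le1 ?ltr0n // ler1n. Qed.

Lemma natr_powRV r D m : (0 < D)%N -> (r ^ D <= m)%N ->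
  r%:R <= powR m%:R D%:R^-1 :> R.
Proof.
move=> D0 rm; have -> : r%:R = powR (r ^ D)%:R D%:R^-1 :> R.
  by rewrite natrX -powR_mulrn // -powRrM divff ?powRr1 // pnatr_eq0 -lt0n.
by apply: ge0_ler_powR; rewrite ?invr_ge0 ?nnegrE ?ler0n ?ler_nat.
Qed.

Lemma powR_split D m : (0 < D)%N -> (0 < m)%N ->
  powR m%:R (1 - D%:R^-1) * powR m%:R D%:R^-1 = m%:R :> R.
Proof.
move=> D0 m0; rewrite -powRD ?subrK ?powRr1 //.
by apply/implyP => _; rewrite pnatr_eq0 -lt0n.
Qed.

Lemma natr_powR_pred r D m : (0 < D)%N -> (r ^ D <= m)%N ->
  (r ^ D.-1)%:R <= powR m%:R (1 - D%:R^-1) :> R.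
Proof.
move=> D0 rm; have -> : (r ^ D.-1)%:R = powR (r ^ D)%:R (1 - D%:R^-1) :> R.
  rewrite !natrX -!powR_mulrn // -powRrM mulrBr mulr1 divff ?pnatr_eq0 -?lt0n //.
  by rewrite -[in RHS](prednK D0) -natr1 addrK.
by apply: ge0_ler_powR; rewrite ?exponent_ge0 ?nnegrE ?ler0n ?ler_nat.
Qed.

Lemma powR_ge1 D m : (0 < D)%N -> (0 < m)%N -> 1 <= powR m%:R (1 - D%:R^-1) :> R.
Proof.
move=> D0 m0; have := @natr_powR_pred 1 D m D0.
by rewrite !exp1n; apply.
Qed.

End Powers.

(** For D >= 2, take the least scale i with [#|U| <= K * 2 ^ (i * D)]; minimality turns the power of
    2 in the incidence bound into |U|^(1 - 1/D). *)
Lemma one_sided_bound (R : realType) D t s : (0 < D)%N -> (0 < s)%N ->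
  exists2 C : R, 0 <= C & forall (F : fieldType) (U V : finType)
    (adj : U -> V -> bool) k (pt : U -> 'rV[F]_D) (g : 'I_k -> V -> {mpoly F[D]})
    (Phi : bool_formula k),
  injective pt -> (k <= t)%N -> (forall i y, msize (g i y) <= t.+1)%N ->
  (forall x y, adj x y = bf_eval (fun i => (g i y).@[pt x 0] == 0) Phi) ->
  Kfree adj s ->
  (inc adj setT)%:R <= C * (powR #|U|%:R (1 - D%:R^-1) * #|V|%:R + #|U|%:R).
Proof.
move=> D0 s0; have [D1|D1] := leqP D 1.
  have {D0 D1} -> : D = 1%N by apply/eqP; rewrite eqn_leq D1.
  exists ((s + s * (t * t) + t * t) + s)%:R => [//|F U V adj k pt g Phi inj kt gt adjE Kf].
  have := near_trivial_incidence (near_trivial_line inj kt gt adjE) Kf.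
  set c := (_ + t * t)%N => H; rewrite invr1 subrr powRr0 mul1r -natrD -natrM ler_nat.
  by apply: (leq_trans H); rewrite mulnDl leq_add // leq_mul2l ?leq_addr ?leq_addl orbT.
have [d ad] := exp_beats_poly ((t * t).+1 ^ D) D.
pose a := ((t * t).+1 ^ D)%N; pose K := (s * a * 2 ^ D)%N.
pose C1 := ((s * d).+1 * K * 2 ^ D)%N.
exists (C1 * 2 ^ D + s)%:R => [//|F U V adj k pt g Phi inj kt gt adjE Kf].
have sh := traces_algebraic kt gt adjE.
have H i : (#|U| <= K * 2 ^ (i * D) ->
    inc adj setT <= C1 * 2 ^ (i * D.-1) * #|V| + s * #|U|)%N.
  by rewrite -cardsT; apply: (dyadic_incidence s0 D1 Kf sh (shattered_lt sh ad)).
clearbody C1.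
suff [P PU incP] : exists2 P : nat, P%:R <= powR #|U|%:R (1 - D%:R^-1) :> R &
    (inc adj setT <= C1 * 2 ^ D * (P * #|V|) + s * #|U|)%N.
  apply: (@le_trans _ _ (C1 * 2 ^ D * (P * #|V|) + s * #|U|)%:R); first by rewrite ler_nat.
  rewrite !natrD mulrDl lerD // natrM ler_wpM2l ?ler0n //; last first.
    by rewrite lerDr mulr_ge0 ?powR_ge0.
  by rewrite natrM -[leLHS]addr0 lerD // ler_wpM2r.
have K0 : (0 < K)%N by rewrite !muln_gt0 s0 !expn_gt0.
have ex : exists i, (#|U| <= K * 2 ^ (i * D))%N.
  exists #|U|; apply: (@leq_trans (2 ^ (#|U| * D))); last by rewrite leq_pmull.
  apply: ltnW; apply: leq_trans (ltn_expl _ (ltnSn 1)) _.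
  by rewrite leq_exp2l // leq_pmulr.
case: (ex_minnP ex) => -[|i] Ui imin.
  (* At scale 0 minimality gives nothing. An empty U forces P = 0, because 0 to a positive power is
     0. *)
  have [U0|U0] := posnP #|U|.
    exists 0%N; first exact: powR_ge0.
    rewrite /inc big1 // => y _; apply/eqP; rewrite -leqn0 -U0; exact: max_card.
  exists 1%N; first exact: powR_ge1.
  apply: leq_trans (H _ Ui) _; rewrite mul0n muln1 mul1n leq_add2r leq_mul2r.
  by rewrite leq_pmulr ?orbT // expn_gt0.
exists ((2 ^ i) ^ D.-1)%N.
  apply: natr_powR_pred => //; rewrite -expnM.
  have : ~~ (#|U| <= K * 2 ^ (i * D))%N by apply/negP => /imin; rewrite ltnn.
  rewrite -ltnNge => /ltnW; apply: leq_trans; exact: leq_pmull.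
apply: leq_trans (H _ Ui) _; rewrite mulnA leq_add2r leq_mul2r -!mulnA leq_mul2l.
by rewrite mulSn expnD -expnM leq_mul2r leq_exp2l // leq_pred !orbT.
Qed.

Lemma incE (U V : finType) (adj : U -> V -> bool) :
  inc adj setT = (\sum_x \sum_y adj x y)%N.
Proof.
rewrite exchange_big; apply: eq_bigr => y _; rewrite setTI -sum1_card big_mkcond.
by apply: eq_bigr => x _; rewrite inE; case: (adj x y).
Qed.

Lemma inc_swap (U V : finType) (adj : U -> V -> bool) :
  inc (fun y x => adj x y) setT = inc adj setT.
Proof. by rewrite !incE exchange_big. Qed.

Lemma Kfree_swap (U V : finType) (adj : U -> V -> bool) s :
  Kfree adj s -> Kfree (fun y x => adj x y) s.
Proof. by move=> Kf B A cB cA H; apply: (Kf A B) => // x y xA yB; apply: H. Qed.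

(** * Passage from finite subsets to finite types *)

Section FsetGraph.
Local Open Scope fset_scope.
Variables (T T' : choiceType) (P : {fset T}) (Q : {fset T'}) (adj : T -> T' -> bool).

Lemma card_edges : #|` edges P Q adj| = inc (fun (x : P) (y : Q) => adj (val x) (val y)) setT.
Proof.
rewrite incE pair_big -big_mkcond sum1_card.
have -> : edges P Q adj =
   [fset (val e.1, val e.2) | e in [pred e : P * Q | adj (val e.1) (val e.2)]].
  apply/fsetP => -[x y]; rewrite !inE /=; apply/andP/imfsetP => /=.
    case=> /andP[xP yQ] a; exists ([` xP], [` yQ]) => //.
  by case=> -[[x' x'P] [y' y'Q]] /= a [-> ->]; rewrite x'P y'Q.
rewrite card_imfset /=; last by move=> [x y] [x' y'] [/val_inj -> /val_inj ->].
by rewrite cardE.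
Qed.

Lemma Kfree_fset s : ~ contains_Kss P Q adj s ->
  Kfree (fun (x : P) (y : Q) => adj (val x) (val y)) s.
Proof.
move=> nK A B cA cB H; apply: nK.
exists [fset val x | x in A], [fset val y | y in B]; split.
- by apply/fsubsetP => _ /imfsetP[x _ ->]; apply: valP.
- by apply/fsubsetP => _ /imfsetP[x _ ->]; apply: valP.
- by rewrite card_imfset ?cA //=; [rewrite -cardE | apply: val_inj].
- by rewrite card_imfset ?cA //=; [rewrite -cardE | apply: val_inj].
- by move=> _ _ /imfsetP[x xA ->] /imfsetP[y yB ->]; apply: H.
Qed.

End FsetGraph.

(** The one-sided bound is applied with each part in turn as the set of points. The linear terms
    cannot be dropped: a star with m = 1 has n edges and no K_{2,2}, while the minimum is n^(1 -
    1/D2). *)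
Lemma upper_bound (R : realType) D1 D2 t s :
      (0 < D1)%N -> (0 < D2)%N -> (0 < s)%N ->
    exists C : R,
    forall (F : fieldType) (P : {fset 'rV[F]_D1}) (Q : {fset 'rV[F]_D2})
           (adj : 'rV[F]_D1 -> 'rV[F]_D2 -> bool) (m n : nat),
      #|` P|%fset = m -> #|` Q|%fset = n ->
      has_complexity_le t P Q adj ->
      ~ contains_Kss P Q adj s ->
      (#|` edges P Q adj|%fset)%:R <= C * (edge_bound R D1 D2 m n + m%:R + n%:R).
Proof.
move=> D10 D20 s0.
have [C1 C10 H1] := one_sided_bound R t D10 s0.
have [C2 C20 H2] := one_sided_bound R t D20 s0.
exists (C1 + C2) => F P Q adj m n Pm Qn [k [f [Phi [kt ft adjE]]]] nK.
pose a (x : P) (y : Q) := adj (val x) (val y).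
have Kf : Kfree a s by apply: Kfree_fset.
have cP : #|{: P}| = m by rewrite -Pm cardfE.
have cQ : #|{: Q}| = n by rewrite -Qn cardfE.
have b1 : (inc a setT)%:R <= C1 * (powR m%:R (1 - D1%:R^-1) * n%:R + m%:R).
  rewrite -cP -cQ; apply: (H1 F _ _ a k val (fun i y => evall (f i) (val y)) Phi) => //.
  - exact: val_inj.
  - by move=> i y; apply: leq_trans (msize_evall _ _) (ft i).
  - move=> x y; rewrite /a (adjE _ _ (fsvalP x) (fsvalP y)); apply: bf_eval_eq => i.
    by rewrite evallE.
have b2 : (inc a setT)%:R <= C2 * (powR n%:R (1 - D2%:R^-1) * m%:R + n%:R).
  rewrite -inc_swap -cP -cQ.
  apply: (H2 F _ _ _ k val (fun i x => evalr (f i) (val x)) Phi) => //.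
  - exact: val_inj.
  - by move=> i x; apply: leq_trans (msize_evalr _ _) (ft i).
  - move=> y x; rewrite /a (adjE _ _ (fsvalP x) (fsvalP y)); apply: bf_eval_eq => i.
    by rewrite evalrE.
  - exact: Kfree_swap.
rewrite card_edges -/a /edge_bound.
have m0 : 0 <= m%:R :> R by []. have n0 : 0 <= n%:R :> R by [].
have p1 := powR_ge0 (m%:R : R) (1 - D1%:R^-1).
have p2 := powR_ge0 (n%:R : R) (1 - D2%:R^-1).
rewrite minEle; case: ifP => _.
  apply: (le_trans b1); rewrite mulrDl -[leLHS]addr0 lerD //.
    by apply: ler_wpM2l => //; rewrite lerDl.
  by rewrite mulr_ge0 // !addr_ge0 // mulr_ge0.
apply: (le_trans b2); rewrite mulrDl -[leLHS]add0r lerD //.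
  by rewrite mulr_ge0 // !addr_ge0 // mulr_ge0.
by apply: ler_wpM2l => //; rewrite mulrC lerD // lerDl.
Qed.

(** * Random polynomials over finite fields *)

Section RandomPolynomial.
Variables (F : finFieldType) (D1 D2 r : nat).
Local Notation point := ('rV[F]_D1 * 'rV[F]_D2)%type.
Local Notation mon := (bmultinom (D1 + D2) r.+1).
Local Notation coefs := 'rV[F]_#|{: mon}|.
Implicit Types (c : coefs) (p : point) (T : {set point}).

Definition poly_of c : {mpoly F[D1 + D2]} :=
  \sum_(b : mon) c 0 (enum_rank b) *: 'X_[b].

Definition ev c p := (poly_of c).@[row_mx p.1 p.2 0].

Lemma msize_poly_of c : (msize (poly_of c) <= r.+1)%N.
Proof.
apply: (leq_trans (msize_sum _ _ _)); apply/bigmax_leqP => b _.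
by apply: (leq_trans (msizeZ_le _ _)); rewrite msizeX bmdeg.
Qed.

Lemma poly_of_surj (f : {mpoly F[D1 + D2]}) :
  (msize f <= r.+1)%N -> exists c, poly_of c = f.
Proof.
move=> fr; exists (\row_i f@_(enum_val i : mon)); rewrite [RHS](mpolywE fr).
by apply: eq_bigr => b _; rewrite mxE enum_rankK.
Qed.

Lemma evD c c' p : ev (c + c') p = ev c p + ev c' p.
Proof.
rewrite /ev -mevalD; congr (meval _ _); rewrite /poly_of -big_split /=.
by apply: eq_bigr => b _; rewrite mxE scalerDl.
Qed.

Lemma evZ a c p : ev (a *: c) p = a * ev c p.
Proof.
rewrite /ev -mevalZ; congr (meval _ _); rewrite /poly_of scaler_sumr.
by apply: eq_bigr => b _; rewrite mxE scalerA.
Qed.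

(** Multiply, over b in T, a factor X_i - b_i for a coordinate i where a and b differ, and normalise
    at a. *)
Lemma interpolation T a : (#|T| <= r)%N -> a \notin T ->
  exists2 c, ev c a = 1 & forall b, b \in T -> ev c b = 0.
Proof.
move=> Tr aT; pose pt (p : point) : 'I_(D1 + D2) -> F := row_mx p.1 p.2 0.
have sep b : b \in T -> exists i, pt a i != pt b i.
  move=> bT; apply/existsP; rewrite -negb_forall; apply/negP => /forallP E.
  case/negP: aT; have /eq_row_mx[E1 E2] : row_mx a.1 a.2 = row_mx b.1 b.2.
    by apply/rowP => i; apply/eqP/E.
  by rewrite (surjective_pairing a) E1 E2 -surjective_pairing.
pose lin b : {mpoly F[D1 + D2]} :=
  if [pick i | pt a i != pt b i] is Some i then 'X_i - (pt b i)%:MP else 1.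
have linb b : b \in T -> (lin b).@[pt b] = 0.
  move=> /sep[i ni]; rewrite /lin; case: pickP => [j _|/(_ i)]; last by rewrite ni.
  by rewrite mevalB mevalXU mevalC subrr.
have lina b : (lin b).@[pt a] != 0.
  rewrite /lin; case: pickP => [j nj|_]; last by rewrite meval1 oner_eq0.
  by rewrite mevalB mevalXU mevalC subr_eq0.
pose f := \prod_(b in T) lin b.
have fa : f.@[pt a] != 0.
  by rewrite /f rmorph_prod /=; apply/prodf_neq0 => b _; apply: lina.
have fr : (msize f <= r.+1)%N.
  apply: (@leq_trans (\sum_(b in T) 1).+1); last by rewrite sum1_card.
  apply: msize_prod_le => b _; rewrite /lin; case: pickP => [j _|_]; last by rewrite msize1.
  apply: (leq_trans (msizeD_le _ _)); rewrite geq_max msizeU_le /= msizeN.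
  exact: msizeC_le.
have [c cf] := poly_of_surj fr.
exists ((f.@[pt a])^-1 *: c).
  by rewrite evZ /ev cf mulVf.
move=> b bT; have fb : f.@[pt b] = 0.
  by rewrite /f rmorph_prod /= (bigD1 b) //= linb // mul0r.
by rewrite evZ /ev cf fb mulr0.
Qed.

Definition zeros T := [set c | [forall p in T, ev c p == 0]].

(** Adding multiples of the interpolating polynomial g makes the value at a uniform without changing
    the values on T. *)
Lemma card_zerosU1 T a : (#|T| <= r)%N -> a \notin T ->
  (#|zeros (a |: T)| * #|F| = #|zeros T|)%N.
Proof.
move=> Tr aT; have [g ga gT] := interpolation Tr aT.
rewrite -(cardsT F) -cardsX.
pose phi (x : coefs * F) := x.1 + x.2 *: g.
have inj : {in setX (zeros (a |: T)) setT &, injective phi}.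
  move=> [c al] [c' al']; rewrite !inE /= !andbT => /forall_inP z /forall_inP z'.
  have ca : ev c a = 0 by apply/eqP/z; rewrite !inE eqxx.
  have ca' : ev c' a = 0 by apply/eqP/z'; rewrite !inE eqxx.
  rewrite /phi /= => E; have := congr1 (ev^~ a) E.
  rewrite !evD !evZ ga ca ca' !add0r !mulr1 => al_eq.
  by move: E; rewrite al_eq => /addIr ->.
rewrite -(card_in_imset inj); apply: eq_card => c; apply/imsetP/idP.
  move=> [[c' al]]; rewrite !inE /= andbT => /forall_inP z' ->.
  apply/forall_inP => p pT; rewrite evD evZ gT // mulr0 addr0.
  by apply: z'; rewrite !inE pT orbT.
rewrite inE => /forall_inP z; exists (c - ev c a *: g, ev c a); last by rewrite /phi subrK.
rewrite !inE /= andbT; apply/forall_inP => p; rewrite !inE -scaleNr evD evZ.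
case/orP => [/eqP ->|pT]; first by rewrite ga mulr1 subrr.
by rewrite gT // mulr0 addr0 z.
Qed.

Lemma card_zeros T : (#|T| <= r.+1)%N ->
  (#|zeros T| * #|F| ^ #|T| = #|{: coefs}|)%N.
Proof.
have [n] := ubnP #|T|; elim: n T => // n IH T; rewrite ltnS => Tn Tr.
have [->|[a aT]] := set_0Vmem T.
  rewrite cards0 muln1 -(cardsT coefs); apply: eq_card => c; rewrite !inE.
  by apply/forall_inP => p; rewrite inE.
have cT : #|T| = #|T :\ a|.+1 by rewrite (cardsD1 a T) aT.
have Dr : (#|T :\ a| <= r)%N by rewrite -ltnS -cT.
have aD : a \notin T :\ a by rewrite !inE eqxx.
have zT := card_zerosU1 Dr aD; rewrite setD1K // in zT.
rewrite cT expnS mulnA zT IH //.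
  by rewrite -cT.
exact: leqW.
Qed.

Local Notation s := (D1 + D2)%N.

Section Counting.
Hypotheses (rs : r = (s * s)%N).
Variables (P : {set 'rV[F]_D1}) (Q : {set 'rV[F]_D2}).
Hypotheses (Pq : (#|P| <= #|F| ^ D1)%N) (Qq : (#|Q| <= #|F| ^ D2)%N).
Hypotheses (s2 : (1 < s)%N) (PQ : (s * s * #|F| <= #|P| * #|Q|)%N).
Hypothesis (PQ0 : (0 < #|P| * #|Q|)%N).

Definition zero_edges c := [set p in setX P Q | ev c p == 0].
Definition bicliques := [set AB : {set 'rV[F]_D1} * {set 'rV[F]_D2} |
  (AB.1 \subset P) && (#|AB.1| == s) && ((AB.2 \subset Q) && (#|AB.2| == s))].
Definition zero_bicliques c := [set AB in bicliques | c \in zeros (setX AB.1 AB.2)].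

(** The choice s = D1 + D2 enters here: m^s n^s is at most q^(s * s). Each binomial saves a factor
    s!, which is at least 2. *)
Lemma card_bicliques : (4 * #|bicliques| <= #|F| ^ (s * s))%N.
Proof.
have -> : bicliques = setX [set A : {set 'rV[F]_D1} | (A \subset P) && (#|A| == s)]
                           [set B : {set 'rV[F]_D2} | (B \subset Q) && (#|B| == s)].
  by apply/setP => AB; rewrite !inE.
rewrite cardsX !cards_draws.
have half m : (2 * 'C(m, s) <= m ^ s)%N.
  apply: (@leq_trans (s`! * 'C(m, s))).
    by rewrite leq_mul2r (leq_trans s2 (fact_geq s)) orbT.
  rewrite mulnC bin_ffact; elim: s => // k IH; rewrite ffactnSr expnSr.
  by rewrite leq_mul // leq_subr.
rewrite -[4%N]/(2 * 2)%N mulnACA; apply: (leq_trans (leq_mul (half _) (half _))).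
rewrite -expnMn expnM leq_exp2r; last exact: ltnW.
by rewrite expnD leq_mul.
Qed.

Lemma sum_zero_edges :
  (#|F| * (\sum_c #|zero_edges c|) = #|P| * #|Q| * #|{: coefs}|)%N.
Proof.
under eq_bigr do rewrite -sum1dep_card big_mkcondr /=.
rewrite exchange_big /= big_distrr /= -cardsX -sum_nat_const.
apply: eq_bigr => p _; rewrite -big_mkcond sum1dep_card mulnC.
rewrite -(@card_zeros [set p]) ?cards1 // expn1; congr (_ * _)%N; apply: eq_card => c.
rewrite !inE; apply/idP/forall_inP => [e p' /set1P -> //|]; apply; exact: set11.
Qed.

(** Given that a fixed biclique T vanishes, the mean number of edges is at most s^2 + mn/q. Degree
    s^2 allows one point beyond the s^2 points of T to stay independent. *)
Lemma sum_zero_bicliques :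
  (4 * #|F| * (\sum_c #|zero_edges c| * #|zero_bicliques c|)
    <= (s * s * #|F| + #|P| * #|Q|) * #|{: coefs}|)%N.
Proof.
have cF : (0 < #|F|)%N by apply/card_gt0P; exists 0.
(* A point outside the biclique costs a further factor q, a point inside none. *)
have count AB : AB \in bicliques ->
    (#|F| ^ (s * s) * (#|F| * \sum_(c in zeros (setX AB.1 AB.2)) #|zero_edges c|)
      <= (s * s * #|F| + #|P| * #|Q|) * #|{: coefs}|)%N.
  rewrite inE => /andP[/andP[AP /eqP cA] /andP[BQ /eqP cB]].
  set T := setX _ _; have cT : #|T| = (s * s)%N by rewrite cardsX cA cB.
  have TPQ : T \subset setX P Q by rewrite setXS.
  have zT : (#|zeros T| * #|F| ^ (s * s) = #|{: coefs}|)%N.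
    by rewrite -cT card_zeros // cT rs.
  have step p : p \in setX P Q ->
      (#|F| ^ (s * s) * (#|F| * #|[set c in zeros T | ev c p == 0%R]|)
       <= ((p \in T) * #|F| + 1) * #|{: coefs}|)%N.
    move=> pPQ; have [pT|pT] := boolP (p \in T).
      rewrite mul1n addn1 mulSn; apply: leq_trans (leq_addl _ _).
      rewrite mulnCA leq_mul2l -zT mulnC leq_mul2r subset_leq_card ?orbT //.
      by apply/subsetP => c; rewrite inE => /andP[].
    rewrite mul0n add0n mul1n -(@card_zeros (p |: T)); last by rewrite cardsU1 pT cT rs.
    rewrite cardsU1 pT cT add1n expnSr mulnA mulnC leq_mul2r.
    rewrite subset_leq_card ?orbT //; apply/subsetP => c; rewrite !in_set => /andP[/forall_inP z e].
    by apply/forall_inP => p'; rewrite in_setU1 => /orP[/eqP -> //|]; apply: z.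
  have -> : (\sum_(c in zeros T) #|zero_edges c| =
      \sum_(p in setX P Q) #|[set c in zeros T | ev c p == 0%R]|)%N.
    under eq_bigr do rewrite -sum1dep_card big_mkcondr /=.
    rewrite exchange_big /=; apply: eq_bigr => p _.
    by rewrite -big_mkcondr sum1dep_card.
  rewrite !big_distrr /=; 
  apply: (@leq_trans (\sum_(p in setX P Q) ((p \in T) * #|F| + 1) * #|{: coefs}|)%N).
    exact: leq_sum.
  rewrite -big_distrl /= leq_mul2r; apply/orP; right.
  rewrite big_split /= sum1_card cardsX leq_add2r -big_distrl /= leq_mul2r.
  apply/orP; right; rewrite -cT -sum1_card -big_mkcondr /=.
  by rewrite big_mkcond [X in (_ <= X)%N]big_mkcond; apply: leq_sum => p _; case: ifP => // /andP[_ ->].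
have -> : (\sum_c #|zero_edges c| * #|zero_bicliques c| =
    \sum_(AB in bicliques) \sum_(c in zeros (setX AB.1 AB.2)) #|zero_edges c|)%N.
  transitivity (\sum_(c : coefs) \sum_(AB in bicliques | c \in zeros (setX AB.1 AB.2)) #|zero_edges c|)%N.
    apply: eq_bigr => c _; rewrite mulnC -sum_nat_const; apply: eq_bigl => AB.
    by rewrite !inE.
  rewrite (exchange_big_dep (mem bicliques)) /= => [|c AB _ /andP[] //].
  by apply: eq_bigr => AB bAB; apply: eq_bigl => c; rewrite bAB.
have q0 : (0 < #|F| ^ (s * s))%N by rewrite expn_gt0 cF.
move: count; set X := (_ * #|{: coefs}|)%N; move: X => X count.
rewrite -(leq_pmul2l q0) -!mulnA mulnCA.
apply: (@leq_trans (4 * (#|bicliques| * X))%N).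
  rewrite leq_mul2l /= big_distrr big_distrr /=.
  by apply: (@leq_trans (\sum_(AB in bicliques) X)%N); [apply: leq_sum | rewrite sum_nat_const].
by rewrite mulnA leq_mul2r card_bicliques orbT.
Qed.

Lemma good_polynomial : exists2 c,
  zero_bicliques c = set0 & (#|P| * #|Q| <= 2 * #|F| * #|zero_edges c|)%N.
Proof.
have [/existsP[c /andP[/eqP c0 ce]]|no] := boolP [exists c,
  (zero_bicliques c == set0) && (#|P| * #|Q| <= 2 * #|F| * #|zero_edges c|)%N].
  by exists c.
(* If no c works, e < eX + mn/2q for every c: by failure of the edge bound when X = 0, and by e <=
   eX when X >= 1. Summing contradicts the two moment computations. *)
exfalso; have lt c : (2 * #|F| * #|zero_edges c| <
    2 * #|F| * (#|zero_edges c| * #|zero_bicliques c|) + #|P| * #|Q|)%N.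
  have [z|z] := eqVneq (zero_bicliques c) set0.
    rewrite z cards0 !muln0 add0n ltnNge; apply/negP => ce.
    by case/existsP: no; exists c; rewrite z eqxx.
  rewrite -[X in (X < _)%N]addn0 -addnS leq_add // leq_mul2l leq_pmulr ?orbT //.
  by rewrite card_gt0.
have c0 : (0 < #|{: coefs}|)%N by apply/card_gt0P; exists 0.
have : (\sum_(c : coefs) (2 * #|F| * #|zero_edges c|).+1 <=
    \sum_(c : coefs) (2 * #|F| * (#|zero_edges c| * #|zero_bicliques c|) + #|P| * #|Q|))%N.
  by apply: leq_sum => c _; apply: lt.
under eq_bigr do rewrite -addn1.
rewrite !big_split /= !sum_nat_const -!big_distrr /= muln1 [(#|{: coefs}| * _)%N]mulnC.
have := sum_zero_edges; have := sum_zero_bicliques.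
have : ((s * s * #|F| + #|P| * #|Q|) * #|{: coefs}| <=
    (#|P| * #|Q| + #|P| * #|Q|) * #|{: coefs}|)%N by rewrite leq_mul2r leq_add2r PQ orbT.
move: c0; move: (\sum_c _)%N (\sum_c _)%N ((_ + _) * _)%N => X Y Z.
move: (#|P| * #|Q|)%N #|F| #|{: coefs}| => mn q w.
by rewrite mulnDl -!mulnA; move: (q * X)%N (q * Y)%N (mn * w)%N => a b c; lia.
Qed.

End Counting.

End RandomPolynomial.

(** * Choice of the field and the lower bound *)

Lemma card_set_of_fset (T : finType) (A : {fset T}) :
  #|[set x | x \in A]| = #|` A|%fset.
Proof. by rewrite cardsE; apply/card_uniqP/fset_uniq. Qed.

Lemma card_fset_of_set (T : finType) (A : {set T}) :
  #|` [fset x | x in A]%fset|%fset = #|A|.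
Proof.
rewrite -card_set_of_fset; apply: eq_card => x; rewrite inE.
by apply/imfsetP/idP => [[y yA ->]|xA] //; exists x.
Qed.

(** Take the least power q = 2^(k+1) for which both parts fit in their spaces; q/2 then fails for
    one of them. The condition m > 1 excludes q = 1. *)
Lemma dyadic_scale D1 D2 m n : (0 < D1)%N -> (0 < D2)%N -> (1 < m)%N ->
  exists k : nat, [/\ (m <= (2 ^ k.+1) ^ D1)%N, (n <= (2 ^ k.+1) ^ D2)%N &
    ((2 ^ k) ^ D1 <= m)%N \/ ((2 ^ k) ^ D2 <= n)%N].
Proof.
move=> D10 D20 m1.
have big a D : (0 < D)%N -> (a <= (2 ^ (m + n)) ^ D)%N || (m + n < a)%N.
  move=> D0; rewrite orbC; case: leqP => //= am.
  rewrite -expnM; apply: ltnW; apply: leq_ltn_trans am _.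
  by apply: leq_ltn_trans (leq_pmulr _ D0) (ltn_expl _ _).
have ex : exists k, (m <= (2 ^ k) ^ D1)%N && (n <= (2 ^ k) ^ D2)%N.
  exists (m + n)%N; have := big m D1 D10; have := big n D2 D20.
  by rewrite ![(m + n < _)%N]ltnNge leq_addl leq_addr !orbF => -> ->.
case: (ex_minnP ex) => -[|k]; rewrite ?expn0 ?exp1n.
  by rewrite leqNgt m1.
move=> /andP[mk nk] kmin; exists k; split=> //.
have : ~~ ((m <= (2 ^ k) ^ D1)%N && (n <= (2 ^ k) ^ D2)%N).
  by apply/negP => /kmin; rewrite ltnn.
by rewrite negb_and -!ltnNge => /orP[/ltnW|/ltnW]; [left | right].
Qed.

Lemma lower_bound (R : realType) (D1 D2 : nat) : (0 < D1)%N -> (0 < D2)%N ->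
    exists t N : nat,
    forall m n s : nat, (N <= m)%N -> (N <= n)%N -> (D1 + D2 <= s)%N ->
    exists (F : fieldType) (P : {fset 'rV[F]_D1}) (Q : {fset 'rV[F]_D2})
           (adj : 'rV[F]_D1 -> 'rV[F]_D2 -> bool),
      [/\ #|` P|%fset = m,
          #|` Q|%fset = n,
          has_complexity_le t P Q adj,
          ~ contains_Kss P Q adj s
        & 4%:R^-1 * edge_bound R D1 D2 m n <= (#|` edges P Q adj|%fset)%:R].
Proof.
move=> D10 D20; pose s := (D1 + D2)%N.
have s2 : (1 < s)%N by rewrite /s; lia.
(* The first value is the degree of the random polynomial; the second makes s^2 * q = 2 * s^2 * 2^k
   at most mn, one part being at least 2^k and the other at least 2 * s^2. *)
exists (s * s)%N, (2 * (s * s))%N => m n s' Nm Nn ss'.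
have ss2 : (1 < s * s)%N := leq_trans s2 (leq_pmulr s (ltnW s2)).
have m1 : (1 < m)%N by lia.
have [k [mk nk kmin]] := dyadic_scale n D10 D20 m1.
have [F _ cF] := pPrimePowerField (isT : prime 2) (ltn0Sn k).
have [P0 _ cP] : exists2 A : {set 'rV[F]_D1}, A \subset setT & #|A| = m.
  by apply: subset_of_card; rewrite cardsT card_mx mul1n cF.
have [Q0 _ cQ] : exists2 A : {set 'rV[F]_D2}, A \subset setT & #|A| = n.
  by apply: subset_of_card; rewrite cardsT card_mx mul1n cF.
have rpos : (0 < 2 ^ k)%N by rewrite expn_gt0.
have big : (s * s * #|F| <= m * n)%N.
  have self D : (0 < D)%N -> (2 ^ k <= (2 ^ k) ^ D)%N.
    by case: D => // D _; rewrite expnS leq_pmulr // expn_gt0 rpos.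
  rewrite cF expnS; case: kmin => [/(leq_trans (self _ D10))|/(leq_trans (self _ D20))] le.
    by apply: (@leq_trans (2 ^ k * (2 * (s * s)))); [lia | apply: leq_mul].
  by apply: (@leq_trans (2 * (s * s) * 2 ^ k)); [lia | apply: leq_mul].
have [c cK ce] : exists2 c, zero_bicliques (r := (s * s)%N) P0 Q0 c = set0
    & (#|P0| * #|Q0| <= 2 * #|F| * #|zero_edges P0 Q0 c|)%N.
  apply: good_polynomial; rewrite ?cP ?cQ ?cF //.
  - by rewrite -cF.
  - by rewrite muln_gt0; lia.
pose P := [fset x | x in P0]%fset; pose Q := [fset y | y in Q0]%fset.
have inP x : (x \in P) = (x \in P0) by rewrite inE.
have inQ x : (x \in Q) = (x \in Q0) by rewrite inE.
pose adj x y := ev c (x, y) == 0.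
exists F, P, Q, adj; split.
- by rewrite card_fset_of_set.
- by rewrite card_fset_of_set.
- exists 1%N, (fun=> poly_of c), (BVar ord0); split=> //; first exact: ltnW.
  by move=> _; apply: msize_poly_of.
(* A copy of the larger biclique of size s' contains one of size s = D1 + D2, which the polynomial
   avoids. *)
- move=> [A [B [AP BQ cA cB AB]]].
  have [A1 A1A cA1] : exists2 A1 : {set 'rV[F]_D1}, A1 \subset [set x | x \in A] & #|A1| = s.
    by apply: subset_of_card; rewrite card_set_of_fset cA.
  have [B1 B1B cB1] : exists2 B1 : {set 'rV[F]_D2}, B1 \subset [set x | x \in B] & #|B1| = s.
    by apply: subset_of_card; rewrite card_set_of_fset cB.
  have /setP/(_ (A1, B1)) := cK; rewrite !inE /= cA1 cB1 !eqxx !andbT => /negP; apply.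
  apply/andP; split; first (apply/andP; split).
  + apply/subsetP => x /(subsetP A1A); rewrite inE -inP; exact: (fsubsetP AP).
  + apply/subsetP => x /(subsetP B1B); rewrite inE -inQ; exact: (fsubsetP BQ).
  + apply/forall_inP => -[x y]; rewrite !inE /= => /andP[/(subsetP A1A) xA /(subsetP B1B) yB].
    by apply: AB; [move: xA | move: yB]; rewrite inE.
have cE : #|` edges P Q adj|%fset = #|zero_edges P0 Q0 c|.
  rewrite -card_set_of_fset; apply: eq_card => -[x y]; rewrite !inE /=.
  by rewrite /adj.
rewrite cE; move: ce; rewrite cP cQ cF expnS mulnA; set e := #|_|; move: e => e ce.
(* Since q = 2 * 2^k, mn/2q is mn/(4 * 2^k), whence the constant 1/4; 2^k is at most m^(1/D1) or
   n^(1/D2). *)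
have {}ce : m%:R * n%:R <= 4%:R * e%:R * (2 ^ k)%:R :> R.
  by rewrite -!natrM ler_nat; apply: (leq_trans ce); lia.
have r0 : 0 < (2 ^ k)%:R :> R by rewrite ltr0n.
have m0 : 0 <= m%:R :> R by []. have n0 : 0 <= n%:R :> R by [].
rewrite mulrC ler_pdivrMr ?ltr0n // mulrC -(ler_pM2r r0); apply: le_trans ce.
have mpos : (0 < m)%N by lia. have npos : (0 < n)%N by lia.
case: kmin => le.
  apply: (@le_trans _ _ (powR m%:R (1 - D1%:R^-1) * n%:R * (2 ^ k)%:R)).
    by apply: ler_wpM2r; [exact: ltW | rewrite /edge_bound ge_min lexx].
  rewrite mulrAC; apply: ler_wpM2r => //; rewrite -[leRHS](powR_split R D10 mpos).
  by apply: ler_wpM2l; [exact: powR_ge0 | exact: natr_powRV].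
apply: (@le_trans _ _ (m%:R * powR n%:R (1 - D2%:R^-1) * (2 ^ k)%:R)).
  by apply: ler_wpM2r; [exact: ltW | rewrite /edge_bound ge_min lexx orbT].
rewrite -mulrA; apply: ler_wpM2l => //; rewrite -[leRHS](powR_split R D20 npos).
by apply: ler_wpM2l; [exact: powR_ge0 | exact: natr_powRV].
Qed.

Local Open Scope fset_scope.
Local Open Scope ring_scope.

Theorem theorem1p3 (R : realType) :
  (forall D1 D2 t s : nat,
      (0 < D1)%N -> (0 < D2)%N -> (0 < t)%N -> (0 < s)%N ->
    exists C : R,
    forall (F : fieldType) (P : {fset 'rV[F]_D1}) (Q : {fset 'rV[F]_D2})
           (adj : 'rV[F]_D1 -> 'rV[F]_D2 -> bool) (m n : nat),
      #|` P| = m -> #|` Q| = n ->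
      has_complexity_le t P Q adj ->
      ~ contains_Kss P Q adj s ->
      (#|` edges P Q adj|)%:R <= C * (edge_bound R D1 D2 m n + m%:R + n%:R))
  /\
  (exists2 c : R, 0 < c &
    forall D1 D2 : nat, (0 < D1)%N -> (0 < D2)%N ->
    exists t N : nat,
    forall m n s : nat, (N <= m)%N -> (N <= n)%N -> (D1 + D2 <= s)%N ->
    exists (F : fieldType) (P : {fset 'rV[F]_D1}) (Q : {fset 'rV[F]_D2})
           (adj : 'rV[F]_D1 -> 'rV[F]_D2 -> bool),
      [/\ #|` P| = m,
          #|` Q| = n,
          has_complexity_le t P Q adj,
          ~ contains_Kss P Q adj s
        & c * edge_bound R D1 D2 m n <= (#|` edges P Q adj|)%:R]).
Proof.
split=> [D1 D2 t s D10 D20 _ s0|]; first exact: upper_bound.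
by exists 4%:R^-1 => [|D1 D2]; [rewrite invr_gt0 ltr0n | apply: lower_bound].
Qed.
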